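(* Let $G$ be a finite group and let $\mathbb{R}[G]$ be its real group algebra with the involution $*$ given by $\left(\sum_{g\in G}a_g g\right)^*=\sum_{g\in G}a_g g^{-1}$. Then the polarization constant of $(\mathbb{R}[G],* )$ is $$\kappa(\mathbb{R}[G],* )=\frac{1}{|G|}\sum_{g\in G}\left(\sum_{\chi\in\mathrm{Irr}(G)}\frac{(\deg\chi)^2\cdot\overline{\chi(g)}}{\deg\chi+s(\chi)}\right)\cdot g .$$
   Context: $\mathrm{Irr}(G)$ is the set of irreducible complex characters of $G$; $\deg\chi=\chi(e_G)$ with $e_G$ the identity of $G$; $s(\chi)=\frac{1}{|G|}\sum_{g\in G}\chi(g^2)$ is the Frobenius–Schur indicator, which equals $1$, $0$ or $-1$ according to whether the representation affording $\chi$ is real, complex or quaternionic. The identity in the claim may be read in $\mathbb{C}[G]\supset\mathbb{R}[G]$. A $*$-algebra $(\mathfrak{A},* )$ is a finite-dimensional unital associative algebra over $\mathbb{R}$ equipped with an $\mathbb{R}$-linear map (involution) $\alpha\mapsto\alpha^*$ satisfying $(\alpha\beta)^*=\beta^*\alpha^*$ and $(\alpha^* )^*=\alpha$, with its natural topology as a finite-dimensional real vector space. Its unitary group is $\Gamma(\mathfrak{A},* )=\{u\in\mathfrak{A}: uu^*=1_{\mathfrak{A}}\}$. A closed subgroup $K\subset\Gamma(\mathfrak{A},* )$ generates $\mathfrak{A}$ if $\mathfrak{A}$ is the smallest $*$-subalgebra containing $K$ (equivalently, $\mathrm{span}_{\mathbb{R}}K=\mathfrak{A}$). $(\mathfrak{A},*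 )$ is polarizable if $\Gamma(\mathfrak{A},* )$ is compact and generates $\mathfrak{A}$; $(\mathbb{R}[G],* )$ is polarizable. A compact subgroup $K\subset\Gamma(\mathfrak{A},* )$ is polarizing if it generates $\mathfrak{A}$ and $\int_K k\,dk=0$ (normalized Haar measure). A Hermitian form on a left $\mathfrak{A}$-module $\mathsf{X}$ is a map $Q:\mathsf{X}\times\mathsf{X}\to\mathfrak{A}$ that is additive and left $\mathfrak{A}$-linear in the first argument and satisfies $Q(x,y)^*=Q(y,x)$. The polarization constant of a polarizable $*$-algebra $(\mathfrak{A},* )$ is the element $\kappa=\kappa(\mathfrak{A},* )\in\mathfrak{A}$ such that $Q(x,y)=\kappa\int_K Q(x+ky,x+ky)\,k\,dk$ for every left $\mathfrak{A}$-module $\mathsf{X}$, every Hermitian form $Q$ on $\mathsf{X}$, every polarizing subgroup $K\subset\Gamma(\mathfrak{A},* )$ and all $x,y\in\mathsf{X}$; such an element exists. *)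

(* Defs.v *)
From HB Require Import structures.
From mathcomp Require Import all_boot all_order all_algebra all_fingroup.
From mathcomp Require Import all_field all_character.
From mathcomp Require Import complex.
From mathcomp Require Import all_classical all_reals all_analysis.
Import numFieldNormedType.Exports.
Import GRing.Theory Num.Theory VectorInternalTheory.

Set Implicit Arguments.
Unset Strict Implicit.
Unset Printing Implicit Defensive.

Local Open Scope classical_set_scope.
Local Open Scope ring_scope.

HB.mixin Record Falgebra_isStar (R : nzRingType) A of Falgebra R A := {
  star : A -> A;
  star_linear : linear star;
  starM : forall a b : A, star (a * b) = star b * star a;
  starK : forall a : A, star (star a) = a
}.

#[short(type="starAlgType")]
HB.structure Definition StarAlgebra (R : nzRingType) :=
  { A of Falgebra R A & Falgebra_isStar R A }.

(* [v2r] is a linear isomorphism onto the row vectors ['rV[R]_(dim A)], so the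
   topology it induces is the one of [A] as a finite-dimensional vector space. *)
Definition natural_topology (R : realType) (A : starAlgType R) : Type :=
  initial_topology (v2r : A -> 'rV[R]_(dim A)).

HB.instance Definition _ (R : realType) (A : starAlgType R) :=
  Topological.copy (natural_topology A)
    (initial_topology (v2r : A -> 'rV[R]_(dim A))).
HB.instance Definition _ (R : realType) (A : starAlgType R) :=
  isPointed.Build (natural_topology A) (0 : A).

Definition borel (R : realType) (A : starAlgType R) :=
  g_sigma_algebraType (@open (natural_topology A)).

Section StarAlgebraTheory.
Variables (R : realType) (A : starAlgType R).

Definition unitary_group : set A := [set u | u * star u = 1].

Definition is_subgroup (K : set A) : Prop :=
  [/\ K 1, (forall u v, K u -> K v -> K (u * v)) & (forall u, K u -> K u^-1)].

(* [{aspace A}] only asks for a unit of the subspace itself, but [B] contains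
   [1] as soon as it contains a subgroup of [unitary_group]. *)
Definition generates (K : set A) : Prop :=
  forall B : {aspace A}, (forall b, b \in B -> star b \in B) ->
    (forall k, K k -> k \in B) -> B = fullv :> {vspace A}.

(* The normalized Haar measure of the compact group [K], as a Borel measure on
   the ambient algebra that is carried by [K]. *)
Definition is_haar (K : set A) (mu : probability (borel A) R) : Prop :=
  mu K = 1%E /\
  forall k, K k -> forall B : set (borel A), measurable B ->
    mu ([set x : A | B (k * x)] : set (borel A)) = mu B.

Definition vintegral (mu : probability (borel A) R) (K : set A) (f : A -> A) :
    A :=
  r2v (\row_j \int[mu]_(k in (K : set (borel A))) v2r (f k) 0 j).

Definition polarizing (K : set A) (mu : probability (borel A) R) : Prop :=
  [/\ K `<=` unitary_group, is_subgroup K,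
      compact (K : set (natural_topology A)), generates K
    & is_haar K mu /\ vintegral mu K (fun k => k) = 0].

Definition hermitian_form (X : lmodType A) (Q : X -> X -> A) : Prop :=
  [/\ forall x y z, Q (x + y) z = Q x z + Q y z,
      forall a x z, Q (a *: x) z = a * Q x z
    & forall x y, star (Q x y) = Q y x].

Definition is_polarization_constant (kappa : A) : Prop :=
  forall (X : lmodType A) (Q : X -> X -> A), hermitian_form Q ->
  forall (K : set A) (mu : probability (borel A) R), polarizing K mu ->
  forall x y : X,
    Q x y = kappa * vintegral mu K (fun k => Q (x + k *: y) (x + k *: y) * k).

End StarAlgebraTheory.

Definition group_algebra (F : fieldType) (gT : finGroupType) : Type :=
  {ffun gT -> F^o}.

HB.instance Definition _ (F : fieldType) (gT : finGroupType) :=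
  Vector.copy (group_algebra F gT) {ffun gT -> F^o}.

Section GroupAlgebra.
Variables (F : fieldType) (gT : finGroupType).
Local Notation FG := (group_algebra F gT).
Implicit Types a b c : FG.

Definition galg_elt (g : gT) : FG := [ffun h => (h == g)%:R].

Definition galg_mul a b : FG := [ffun g => \sum_h a h * b (h^-1 * g)%g].

Definition galg_star a : FG := [ffun g => a g^-1%g].

Let mulA : associative galg_mul.
Proof.
move=> a b c; apply/ffunP=> g; rewrite !ffunE.
under eq_bigr do rewrite ffunE mulr_sumr.
under [RHS]eq_bigr do rewrite ffunE mulr_suml.
rewrite [RHS]exchange_big /=; apply: eq_bigr => h _.
rewrite [RHS](reindex_inj (mulgI h)) /=; apply: eq_bigr => k _.
by rewrite mulrA mulKg invMg mulgA.
Qed.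

Let mul1 : left_id (galg_elt 1%g) galg_mul.
Proof.
move=> a; apply/ffunP=> g; rewrite !ffunE (bigD1 1%g) //= big1 => [|h nh].
  by rewrite ffunE eqxx mul1r invg1 mul1g addr0.
by rewrite ffunE (negPf nh) mul0r.
Qed.

Let mulr1_ : right_id (galg_elt 1%g) galg_mul.
Proof.
move=> a; apply/ffunP=> g; rewrite !ffunE (bigD1 g) //= big1 => [|h nh].
  by rewrite ffunE mulVg eqxx mulr1 addr0.
by rewrite ffunE -eq_mulVg1 (negPf nh) mulr0.
Qed.

Let mulDl : left_distributive galg_mul +%R.
Proof.
move=> a b c; apply/ffunP=> g; rewrite !ffunE -big_split /=.
by apply: eq_bigr => h _; rewrite ffunE mulrDl.
Qed.

Let mulDr : right_distributive galg_mul +%R.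
Proof.
move=> a b c; apply/ffunP=> g; rewrite !ffunE -big_split /=.
by apply: eq_bigr => h _; rewrite ffunE mulrDr.
Qed.

Let one_neq0 : galg_elt 1%g != 0.
Proof.
by apply/eqP=> /ffunP/(_ 1%g)/eqP; rewrite !ffunE eqxx oner_eq0.
Qed.

HB.instance Definition _ := GRing.Zmodule_isNzRing.Build FG
  mulA mul1 mulr1_ mulDl mulDr one_neq0.

Let scaleAl (k : F) (a b : FG) : k *: (a * b) = (k *: a) * b.
Proof.
apply/ffunP=> g; rewrite !ffunE scaler_sumr; apply: eq_bigr => h _.
by rewrite ffunE -scalerAl.
Qed.

HB.instance Definition _ := GRing.Lmodule_isLalgebra.Build F FG scaleAl.

Let scaleAr (k : F) (a b : FG) : k *: (a * b) = a * (k *: b).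
Proof.
apply/ffunP=> g; rewrite !ffunE scaler_sumr; apply: eq_bigr => h _.
by rewrite ffunE -scalerAr.
Qed.

HB.instance Definition _ := GRing.Lalgebra_isAlgebra.Build F FG scaleAr.
HB.instance Definition _ := Algebra_isFalgebra.Build F FG.

Let sgalg_linear : linear galg_star.
Proof. by move=> k a b; apply/ffunP=> g; rewrite !ffunE. Qed.

Let sgalgM (a b : FG) : galg_star (a * b) = galg_star b * galg_star a.
Proof.
apply/ffunP=> g; rewrite !ffunE.
rewrite (reindex_inj (mulgI g^-1%g)) (reindex_inj invg_inj) /=.
rewrite (reindex_inj invg_inj) /=; apply: eq_bigr => h _.
by rewrite !ffunE !invMg !invgK -mulgA mulgV mulg1 mulrC.
Qed.

Let sgalgK (a : FG) : galg_star (galg_star a) = a.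
Proof. by apply/ffunP=> g; rewrite !ffunE invgK. Qed.

HB.instance Definition _ := Falgebra_isStar.Build F FG
  sgalg_linear sgalgM sgalgK.

End GroupAlgebra.

Definition galg_complex (R : realType) (gT : finGroupType)
    (a : group_algebra R gT) : group_algebra R[i] gT :=
  [ffun g => real_complex R (a g)].

(* Characters take their values in [C = R[i]], whereas the irreducible
   characters ['chi_i] of the library are [algC]-valued.  This set is finite, so
   a finitely supported sum [\sum_(chi \in Irr _)] over it is the full sum. *)
Definition Irr (C : fieldType) (gT : finGroupType) : set {ffun gT -> C} :=
  [set chi | exists (n : nat) (rG : mx_representation C [set: gT]%G n),
     mx_irreducible rG /\ chi = [ffun g => \tr (rG g)]].

Definition deg (C : fieldType) (gT : finGroupType) (chi : {ffun gT -> C}) : C :=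
  chi 1%g.

Definition frobenius_schur (C : fieldType) (gT : finGroupType)
    (chi : {ffun gT -> C}) : C :=
  #|gT|%:R^-1 * \sum_(g : gT) chi (g ^+ 2)%g.

(* Main.v *)
From HB Require Import structures.
Require Import Defs.
From mathcomp Require Import all_boot all_order all_algebra all_fingroup.
From mathcomp Require Import all_solvable all_field all_character.
From mathcomp Require Import complex.
From mathcomp Require Import all_classical all_reals all_analysis.
From mathcomp Require Import measurable_realfun.
From mathcomp Require Import ring.
Import numFieldNormedType.Exports.
Import Order.TTheory GRing.Theory Num.Theory VectorInternalTheory.

(** Since [k] is unitary, [Q (x + k y) (x + k y) k] expands to
    [Q x x k + Q x y + k (Q x y)^* k + k Q y y].  The outer terms integrate to
    zero because [k] does, and there remains [Q x y] plus the integral of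
    [k a^* k] at [a = Q x y].  By left invariance of the Haar measure the map
    [a |-> \int k a^* k] commutes with left multiplication by each element of
    [K], hence by the whole algebra, which [K] spans; so it is right
    multiplication by [\int k^2] ([vintegral_sandwich]), and the integral in
    the definition equals [Q x y (1 + \int k^2)] ([vintegral_polarized]).

    In the group algebra [\int k^2] is always the central element
    [c = |G|^-1 \sum_g g^2] ([vintegral_squares]): averaging over [G] turns
    [\int k^2] into the integral of [|G|^-1 \sum_g g k g k = k^* c k = c].
    So [(1 + c)^-1] is a polarization constant, once [1 + c] is known to be
    invertible.  It is, because left multiplication by each [g^2] is an
    isometry, so that [<x, x + c x>] is a mean of nonnegative numbers, among
    which [g = 1] contributes [2 <x, x>] ([one_plus_square_mean_inj]).
    Uniqueness is tested on the form [x y^*] and the finite polarizing subgroup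
    of the elements [g] and [- g] ([exists_polarizing]).

    For the formula, the multiplicities of the irreducible characters in the
    regular one give
    [a g = |G|^-1 \sum_chi (deg chi) tr (rho_chi (a) rho_chi (g^-1))].  By
    Schur's lemma [1 + c] acts on [chi] as a scalar; taking traces, this scalar
    is [1 + s(chi) / deg chi], so that [(1 + c)^-1] acts as
    [deg chi / (deg chi + s(chi))].  Finally [chi (g^-1)] is the conjugate of
    [chi g], because every representation is unitary for some Hermitian form. *)

Set Implicit Arguments.
Unset Strict Implicit.
Unset Printing Implicit Defensive.

Local Open Scope classical_set_scope.
Local Open Scope ring_scope.

(** * One-sided inverses, unitary elements and the involution *)

(** In finite dimension left multiplication by [v] is injective, hence onto. *)
Lemma falg_mulV (F : fieldType) (B : falgType F) (u v : B) :
  u * v = 1 -> v * u = 1.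
Proof.
move=> uv1; have v0 : lker (amull v) == 0%VS.
  apply/lker0P => x y; rewrite !lfunE /= => vxy.
  by rewrite -[x]mul1r -uv1 -mulrA vxy mulrA uv1 mul1r.
have := lker0_lfunVK v0 1; rewrite lfunE /= => vw1.
by rewrite -[u in LHS]mulr1 -vw1 (mulrA u) uv1 mul1r vw1.
Qed.

Lemma falg_unit (F : fieldType) (B : falgType F) (u v : B) :
  u * v = 1 -> u \is a GRing.unit.
Proof. by move=> uv1; apply/unitrP; exists v; rewrite uv1 falg_mulV. Qed.

Lemma unitary_starK (R : realType) (A : starAlgType R) (u : A) :
  unitary_group u -> star u * u = 1.
Proof. exact: falg_mulV. Qed.

Lemma unitaryV (R : realType) (A : starAlgType R) (u : A) :
  unitary_group u -> u^-1 = star u.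
Proof.
by move=> uU; rewrite -[u^-1]mulr1 -uU mulKr // (falg_unit uU).
Qed.

HB.instance Definition _ (R : nzRingType) (A : starAlgType R) :=
  GRing.isLinear.Build R A A _ (@star R A) (@star_linear R A).

Section Star.
Variables (R : realType) (A : starAlgType R).

Lemma star1 : star (1 : A) = 1.
Proof. by rewrite -[LHS]mul1r -[X in X * _]starK -starM mul1r starK. Qed.

Lemma starD (a b : A) : star (a + b) = star a + star b.
Proof. exact: (linearD (@star R A)). Qed.

End Star.

(** * Integration of polynomial maps on a compact set *)

Section Coordinates.
Variables (R : realType) (A : starAlgType R).

Lemma v2r_linear_coord (f : {linear A -> A}) a j :
  v2r (f a) 0 j = \sum_i v2r a 0 i * v2r (f (r2v (delta_mx 0 i))) 0 j.
Proof.
rewrite -[in LHS](v2rK a) [in LHS](row_sum_delta (v2r a)) !linear_sum summxE.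
by apply: eq_bigr => i _; rewrite !linearZ mxE.
Qed.

Lemma continuous_coord j :
  continuous ((fun a => v2r a 0 j) : natural_topology A -> R).
Proof.
move=> x; apply: (@continuous_comp (natural_topology A) 'rV[R]_(dim A) R
  v2r (fun M : 'rV[R]_(dim A) => M 0 j)); first exact: initial_continuous.
exact: coord_continuous.
Qed.

Lemma continuous_linear_natural (f : {linear A -> A}) :
  continuous (f : natural_topology A -> natural_topology A).
Proof.
apply: continuous_comp_initial => x U [P nP sPU].
have cf j : continuous ((fun a => v2r (f a) 0 j) : natural_topology A -> R).
  rewrite (_ : (fun a => _) = (fun a : natural_topology A => \sum_i v2r a 0 i *
      v2r (f (r2v (delta_mx 0 i))) 0 j)); last first.
    by apply/funext => a; exact: v2r_linear_coord.
  move=> y; have Fy := @nbhs_filter (natural_topology A) y.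
  apply: (@cvg_big R _ +%R 0 xpredT add_continuous _ _ _ _ _ Fy) => i _.
  by apply: (@cvgM _ _ _ Fy); [exact: continuous_coord | exact: cvg_cst].
have Fx := @nbhs_filter (natural_topology A) x.
apply: (@filterS _ _ Fx _ _ _ (filter_forall Fx (fun j => cf j x _ (nP 0 j)))).
by move=> y Py; apply: sPU => i j; rewrite ord1; exact: Py.
Qed.

Lemma hausdorff_natural_topology : hausdorff_space (natural_topology A).
Proof.
move=> x y cxy; apply: (can_inj (v2rK)).
apply: (@norm_hausdorff _ 'rV[R]_(dim A)) => U V Ux Vy.
have [z [Uz Vz]] := cxy _ _ (initial_continuous Ux) (initial_continuous Vy).
by exists (v2r z).
Qed.

End Coordinates.

Section Integral.
Variables (R : realType) (A : starAlgType R).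
Variables (mu : probability (borel A) R) (K : set A).
Hypothesis cK : compact (K : set (natural_topology A)).

Lemma measurable_compact : measurable (K : set (borel A)).
Proof.
rewrite -[K]setCK; apply: measurableC; apply: sub_sigma_algebra.
apply: closed_openC; apply: compact_closed => //.
exact: hausdorff_natural_topology.
Qed.

Lemma measurable_continuous_borel
    (f : natural_topology A -> natural_topology A) :
  continuous f -> measurable_fun [set: borel A] (f : borel A -> borel A).
Proof.
move=> /continuousP cf; apply: (@measurability _ _ (borel A) (borel A) setT f
  (@open (natural_topology A)) erefl).
move=> _ [U oU <-]; rewrite setTI; apply: sub_sigma_algebra; exact: cf.
Qed.

Lemma measurable_coord j :
  measurable_fun [set: borel A] ((fun a => v2r a 0 j) : borel A -> R).
Proof.
apply: (measurability _ (RGenOpens.measurableE R)) => _ [_ [a [b ->] <-]].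
rewrite setTI; apply: sub_sigma_algebra.
by have /continuousP := @continuous_coord R A j; apply; exact: interval_open.
Qed.

(** Coordinate functions on [A] and polynomials in them are tame, which makes
    them integrable on the compact [K] whatever the probability measure. *)
Definition tame (f : A -> R) : Prop :=
  measurable_fun [set: borel A] (f : borel A -> R) /\
  exists M, forall k, K k -> `|f k| <= M.

Lemma tame_cst c : tame (fun=> c).
Proof. by split; [exact: measurable_cst | exists `|c|]. Qed.

Lemma tameD f g : tame f -> tame g -> tame (fun k => f k + g k).
Proof.
move=> [mf [M fM]] [mg [N gN]]; split; first exact: measurable_funD.
by exists (M + N) => k Kk; rewrite (le_trans (ler_normD _ _)) ?lerD ?fM ?gN.
Qed.

Lemma tameM f g : tame f -> tame g -> tame (fun k => f k * g k).
Proof.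
move=> [mf [M fM]] [mg [N gN]]; split; first exact: measurable_funM.
by exists (M * N) => k Kk; rewrite normrM ler_pM ?fM ?gN.
Qed.

Lemma tame_sum (I : finType) (f : I -> A -> R) :
  (forall i, tame (f i)) -> tame (fun k => \sum_i f i k).
Proof.
move=> tf; elim: (index_enum I) => [|i s IHs].
  by under eq_fun do rewrite big_nil; exact: tame_cst.
by under eq_fun do rewrite big_cons; exact: tameD.
Qed.

Lemma tame_coord j : tame (fun k => v2r k 0 j).
Proof.
split; first exact: measurable_coord.
have cKj := @continuous_compact (natural_topology A) R^o (fun a => v2r a 0 j) K
  (continuous_subspaceT (@continuous_coord R A j)) cK.
have [M [_ bM]] := compact_bounded cKj.
by exists (M + 1) => k Kk; apply: bM; rewrite ?ltrDl //; exists k.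
Qed.

Lemma integrable_tame f : tame f ->
  mu.-integrable (K : set (borel A)) (EFin \o (f : borel A -> R)).
Proof.
move=> [mf [M fM]]; have mK := measurable_compact.
apply: measurable_bounded_integrable => //.
- by rewrite (le_lt_trans (probability_le1 _ mK)) ?ltry.
- exact: measurable_funTS.
exists M; split; first exact: num_real.
by move=> N MN k Kk; exact: le_trans (fM _ Kk) (ltW MN).
Qed.

Definition vtame (f : A -> A) : Prop := forall j, tame (fun k => v2r (f k) 0 j).

Lemma vtame_id : vtame id. Proof. exact: tame_coord. Qed.

Lemma vtame_cst c : vtame (fun=> c). Proof. by move=> j; exact: tame_cst. Qed.

Lemma vtameD f g : vtame f -> vtame g -> vtame (fun k => f k + g k).
Proof.
move=> tf tg j; under eq_fun do rewrite linearD mxE.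
by apply: tameD; [exact: tf | exact: tg].
Qed.

Lemma vtame_linear (L : {linear A -> A}) f : vtame f -> vtame (L \o f).
Proof.
move=> tf j; under eq_fun do rewrite v2r_linear_coord.
by apply: tame_sum => i; apply: tameM; [exact: tf | exact: tame_cst].
Qed.

Lemma vtameM f g : vtame f -> vtame g -> vtame (fun k => f k * g k).
Proof.
move=> tf tg j.
have amulrE a b : a * b = amulr b a by rewrite lfunE.
under eq_fun do rewrite amulrE v2r_linear_coord.
apply: tame_sum => i; apply: tameM; first exact: tf.
under eq_fun do rewrite /= lfunE /=.
suff /(_ j) : vtame (amull (r2v (delta_mx 0 i)) \o g).
  by under eq_fun do rewrite /= lfunE.
exact: vtame_linear.
Qed.

Lemma vintegralE f j : v2r (vintegral mu K f) 0 j =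
  \int[mu]_(k in (K : set (borel A))) v2r (f k) 0 j.
Proof. by rewrite r2vK mxE. Qed.

Lemma eq_vintegral f g : (forall k, K k -> f k = g k) ->
  vintegral mu K f = vintegral mu K g.
Proof.
move=> fg; congr r2v; apply/rowP => j; rewrite !mxE.
by apply: eq_Rintegral => k /set_mem Kk; rewrite fg.
Qed.

Lemma vintegralD f g : vtame f -> vtame g ->
  vintegral mu K (fun k => f k + g k) = vintegral mu K f + vintegral mu K g.
Proof.
move=> tf tg; apply: (can_inj v2rK); apply/rowP => j.
rewrite linearD mxE !vintegralE -RintegralD //; first last.
- exact: integrable_tame.
- exact: integrable_tame.
- exact: measurable_compact.
by apply: eq_Rintegral => k _; rewrite linearD mxE.
Qed.

(** In coordinates, [L] is a matrix, which goes through the integrals. *)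
Lemma vintegral_linear (L : {linear A -> A}) f : vtame f ->
  vintegral mu K (L \o f) = L (vintegral mu K f).
Proof.
move=> tf; apply: (can_inj v2rK); apply/rowP => j.
rewrite v2r_linear_coord vintegralE.
have mK := measurable_compact.
transitivity (\sum_i \int[mu]_(k in (K : set (borel A)))
   (v2r (f k) 0 i * v2r (L (r2v (delta_mx 0 i))) 0 j)); last first.
  apply: eq_bigr => i _; rewrite vintegralE -RintegralZr //.
  exact: integrable_tame.
rewrite sum_fine; last first.
  move=> i _; apply: integrable_fin_num => //; apply: integrable_tame.
  by apply: tameM; [exact: tf | exact: tame_cst].
rewrite -integral_sum //; last first.
  move=> i; apply: integrable_tame.
  by apply: tameM; [exact: tf | exact: tame_cst].
congr fine; apply: eq_integral => k _.
by rewrite sumEFin /= v2r_linear_coord.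
Qed.

Lemma vintegral_cst c : mu K = 1%E -> vintegral mu K (fun=> c) = c.
Proof.
move=> K1; have mK := measurable_compact; apply: (can_inj v2rK).
apply/rowP => j; transitivity (v2r c 0 j * fine (mu K)).
  by rewrite vintegralE (Rintegral_cst mu mK).
by rewrite K1 mulr1.
Qed.

(** Left translation by [h] preserves [K], and it preserves [mu] on all Borel
    sets, so this is the change of variables formula for the image measure. *)
Lemma vintegral_translate h f : K `<=` @unitary_group R A -> is_subgroup K ->
  is_haar K mu -> K h -> vtame f ->
  vintegral mu K (fun k => f (h * k)) = vintegral mu K f.
Proof.
move=> KU [_ KM KV] [_ invmu] Kh tf; apply: (can_inj v2rK); apply/rowP => j.
have mK := measurable_compact.
have mh : measurable_fun [set: borel A] ((fun k => h * k) : borel A -> borel A).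
  rewrite (_ : (fun k => _) = amull h); last first.
    by apply/funext => k; rewrite lfunE.
  apply: (@measurable_continuous_borel (amull h)).
  exact: (@continuous_linear_natural R A (amull h)).
have hK : (fun k => h * k) @^-1` K = K.
  apply/seteqP; split=> k /= Kk; last exact: KM.
  by rewrite -[k](mulKr (falg_unit (KU _ Kh))); apply: KM => //; exact: KV.
have [mfj _] := tf j.
have mgj : measurable_fun [set: borel A]
    (EFin \o (fun k : borel A => v2r (f k) 0 j)) by exact/measurable_EFinP.
have intg : mu.-integrable ((fun k : borel A => h * k : borel A) @^-1` K)
    ((EFin \o (fun k : borel A => v2r (f k) 0 j)) \o (fun k => h * k)).
  rewrite hK; apply: integrable_tame; split.
    exact: measurableT_comp mfj mh.
  by have [_ [M fM]] := tf j; exists M => k Kk; apply: fM; exact: KM.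
have := integral_pushforward mh mgj intg mK; rewrite hK => Ipush.
rewrite !vintegralE /Rintegral -[in LHS]Ipush; congr fine.
by apply: eq_measure_integral => B mB _; exact: invmu.
Qed.

End Integral.

Section IntegralMul.
Variables (R : realType) (A : starAlgType R).
Variables (mu : probability (borel A) R) (K : set A).
Hypothesis cK : compact (K : set (natural_topology A)).

Lemma vintegral_mull a f : vtame K f ->
  vintegral mu K (fun k => a * f k) = a * vintegral mu K f.
Proof.
move=> tf; have := vintegral_linear mu cK (amull a) tf.
rewrite /= lfunE /= => <-.
by apply: eq_vintegral => k _; rewrite /= lfunE.
Qed.

Lemma vintegral_mulr a f : vtame K f ->
  vintegral mu K (fun k => f k * a) = vintegral mu K f * a.
Proof.
move=> tf; have := vintegral_linear mu cK (amulr a) tf.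
rewrite /= lfunE /= => <-.
by apply: eq_vintegral => k _; rewrite /= lfunE.
Qed.

Lemma vintegral_sum (I : Type) (r : seq I) (f : I -> A -> A) :
  (forall i, vtame K (f i)) ->
  vintegral mu K (fun k => \sum_(i <- r) f i k) =
    \sum_(i <- r) vintegral mu K (f i).
Proof.
move=> tf.
(* The induction also carries tameness of the partial sums, which additivity
   of the integral requires. *)
suff [] : vintegral mu K (fun k => \sum_(i <- r) f i k)
  = \sum_(i <- r) vintegral mu K (f i)
  /\ vtame K (fun k => \sum_(i <- r) f i k) by [].
elim: r => [|i s [IHs ts]].
  have -> : (fun k => \sum_(i <- [::]) f i k) = fun=> 0.
    by apply/funext => k; rewrite big_nil.
  split; last exact: vtame_cst.
  rewrite big_nil -[RHS](mul0r (vintegral mu K id)) -vintegral_mull //.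
    by apply: eq_vintegral => k _; rewrite mul0r.
  exact: vtame_id.
have -> : (fun k => \sum_(j <- i :: s) f j k) =
    fun k => f i k + \sum_(j <- s) f j k.
  by apply/funext => k; rewrite big_cons.
by split; [rewrite vintegralD // IHs big_cons | exact: vtameD].
Qed.

End IntegralMul.

(** * Mean squares over a polarizing subgroup *)

Section Span.
Variables (R : realType) (A : starAlgType R).

(** A finite subset of [K] with span of maximal dimension spans every element of
    [K].  This span is stable under products since [K] is, and under the
    involution since [star k = k^-1]; as [K] generates, it is everything. *)
Lemma generates_span (K : set A) : K `<=` @unitary_group R A -> is_subgroup K ->
  generates K ->
  exists2 s : seq A, (forall k, k \in s -> K k) & <<(s)>>%VS = fullv.
Proof.
move=> KU [K1 KM KV] Kgen.
pose spanK n := `[< exists2 s : seq A, (forall k, k \in s -> K k) &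
  \dim <<(s)>>%VS = n >].
have ex : exists n, spanK n.
  by exists (\dim <<([::] : seq A)>>%VS); apply/asboolP; exists [::].
have bd n : spanK n -> (n <= dim A)%N.
  by move=> /asboolP[s _ <-]; rewrite -dimvf dimvS // subvf.
case: (ex_maxnP ex bd) => m /asboolP[s sK dims] smax.
exists s => //.
have sub k : K k -> k \in <<(s)>>%VS.
  move=> Kk; have le : (<<(s)>> <= <<(k :: s)>>)%VS.
    by apply: sub_span => x xs; rewrite inE xs orbT.
  suff /eqP-> : <<(s)>>%VS == <<(k :: s)>>%VS by rewrite memv_span ?mem_head.
  rewrite eqEdim le dims /=; apply: smax; apply/asboolP.
  exists (k :: s) => // x; rewrite inE => /predU1P[->//|]; exact: sK.
have mul_s u v : u \in s -> v \in <<(s)>>%VS -> u * v \in <<(s)>>%VS.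
  move=> us vs; have -> : u * v = amull u v by rewrite lfunE.
  rewrite memv_preim.
  apply: subvP v vs; apply/span_subvP => v vs; rewrite -memv_preim lfunE.
  by apply: sub; apply: KM; exact: sK.
have mul_span u v :
    u \in <<(s)>>%VS -> v \in <<(s)>>%VS -> u * v \in <<(s)>>%VS.
  move=> us vs; have -> : u * v = amulr v u by rewrite lfunE.
  rewrite memv_preim.
  apply: subvP u us; apply/span_subvP => u us; rewrite -memv_preim lfunE.
  exact: mul_s.
have star_span b : b \in <<(s)>>%VS -> star b \in <<(s)>>%VS.
  move=> bs; have -> : star b = linfun star b by rewrite lfunE.
  rewrite memv_preim.
  apply: subvP b bs; apply/span_subvP => b bs; rewrite -memv_preim lfunE /=.
  by have Kb := sK _ bs; rewrite -unitaryV; [apply: sub; exact: KV | exact: KU].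
have alg_s : is_aspace <<(s)>>%VS.
  rewrite /is_aspace has_algid1 ?sub //; apply/prodvP => u v; exact: mul_span.
exact: (Kgen (ASpace alg_s)).
Qed.

End Span.

Section Squares.
Variables (R : realType) (A : starAlgType R).
Variables (K : set A) (mu : probability (borel A) R).
Hypothesis polK : polarizing K mu.

Let KU : K `<=` @unitary_group R A. Proof. by case: polK. Qed.
Let Kgrp : is_subgroup K. Proof. by case: polK. Qed.
Let Kc : compact (K : set (natural_topology A)). Proof. by case: polK. Qed.
Let Khaar : is_haar K mu. Proof. by case: polK => _ _ _ _ []. Qed.

Let sandwich_tame a : vtame K (fun k => k * a * k).
Proof.
apply: vtameM => //; last exact: vtame_id.
by apply: vtameM => //; [exact: vtame_id | exact: vtame_cst].
Qed.

(** Write [F a] for the left-hand side.  Replacing [k] by [h k] with [h] in [K]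
    gives [F (h a) = h F a], as [star (h a) h = star a].  Both sides are linear
    in [h] and [K] spans the algebra, so that [F a = F (a 1) = a F 1]. *)
Lemma vintegral_sandwich a :
  vintegral mu K (fun k => k * star a * k) =
    a * vintegral mu K (fun k => k * k).
Proof.
pose F b := vintegral mu K (fun k => k * star b * k).
have F_linear : linear F.
  move=> c b b'; rewrite /F.
  transitivity (vintegral mu K
    (fun k => c *: (k * star b * k) + k * star b' * k)).
    apply: eq_vintegral => k _; rewrite linearP mulrDr mulrDl.
    by rewrite -scalerAr -scalerAl.
  rewrite vintegralD //; last exact: (vtame_linear ( *:%R c)).
  by congr (_ + _); rewrite (vintegral_linear mu Kc ( *:%R c)).
have F0 : F 0 = 0.
  by have := F_linear (-1) 0 0; rewrite scaler0 addr0 scaleN1r addNr.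
have [s sK sA] := generates_span KU Kgrp (let: And5 _ _ _ g _ := polK in g).
suff Fl b : F (a * b) = a * F b.
  have := Fl 1; rewrite mulr1 /F => ->; congr (_ * _).
  by apply: eq_vintegral => k _; rewrite star1 mulr1.
have : a \in <<(in_tuple s)>>%VS by rewrite sA memvf.
move=> /coord_span ->; elim/big_ind : _ => [|u v Fu Fv|i _].
- by rewrite !mul0r.
- by rewrite mulrDl -[u * b]scale1r F_linear Fu Fv scale1r mulrDl.
have Kh : K s`_i by apply: sK; rewrite mem_nth.
set h := s`_i in Kh *; rewrite -scalerAl -[X in F X]addr0 F_linear F0 addr0.
rewrite -scalerAl; congr (_ *: _).
have := vintegral_translate Kc KU Kgrp Khaar Kh (sandwich_tame (star (h * b))).
rewrite /F => <-; rewrite -vintegral_mull //.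
apply: eq_vintegral => k _; rewrite starM !mulrA.
by rewrite -(mulrA _ (star h) h) (unitary_starK (KU Kh)) mulr1.
Qed.

(** Of the four terms of the expanded form, the two in which [k] occurs once
    integrate to zero, as [K] has barycentre zero. *)
Lemma vintegral_polarized (X : lmodType A) (Q : X -> X -> A) x y :
  hermitian_form Q ->
  vintegral mu K (fun k => Q (x + k *: y) (x + k *: y) * k) =
  Q x y * (1 + vintegral mu K (fun k => k * k)).
Proof.
move=> [QD QZ Qs].
have QDr u v w : Q u (v + w) = Q u v + Q u w.
  by rewrite -Qs QD starD !Qs.
have QZr u b w : Q u (b *: w) = Q u w * star b by rewrite -Qs QZ starM Qs.
have tid : vtame K id by exact: vtame_id.
have K1 : mu K = 1%E by case: Khaar.
have k0 : vintegral mu K (fun k => k) = 0 by case: polK => _ _ _ _ [].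
transitivity (vintegral mu K (fun k => Q x x * k + Q x y +
    (k * star (Q x y) * k + k * Q y y))).
  apply: eq_vintegral => k /KU kU.
  rewrite QD QZ !QDr !QZr !Qs !(mulrDr, mulrDl) !mulrA.
  by rewrite -!(mulrA _ (star k) k) (unitary_starK kU) !mulr1.
have t1 : vtame K (fun k => Q x x * k) by apply: vtameM => //; exact: vtame_cst.
have t2 : vtame K (fun=> Q x y) by exact: vtame_cst.
have t3 : vtame K (fun k => k * Q y y) by apply: vtameM => //; exact: vtame_cst.
have i1 : vintegral mu K (fun k => Q x x * k) = 0.
  by rewrite (vintegral_mull mu Kc _ tid) k0 mulr0.
have i3 : vintegral mu K (fun k => k * Q y y) = 0.
  by rewrite (vintegral_mulr mu Kc _ tid) k0 mul0r.
rewrite !vintegralD //; [|exact: vtameD..].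
by rewrite i1 i3 add0r addr0 vintegral_cst // vintegral_sandwich mulrDr mulr1.
Qed.

End Squares.

(** * The mean square in a group algebra *)

Section GroupElements.
Variables (F : fieldType) (gT : finGroupType).
Local Notation FG := (group_algebra F gT).
Local Notation elt := (galg_elt F).

Lemma galg_eltM (g h : gT) : elt (g * h)%g = elt g * elt h :> FG.
Proof.
apply/ffunP => u; rewrite !ffunE (bigD1 g) //= big1 => [|v ngv].
  by rewrite !ffunE eqxx mul1r addr0 (can2_eq (mulKVg g) (mulKg g)).
by rewrite ffunE (negPf ngv) mul0r.
Qed.

Lemma galg_elt1 : elt 1%g = 1 :> FG. Proof. by []. Qed.

Lemma star_galg_elt (g : gT) : star (elt g : FG) = elt g^-1%g.
Proof. by apply/ffunP => u; rewrite !ffunE (can2_eq invgK invgK). Qed.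

Lemma galg_sum (a : FG) : a = \sum_g a g *: (elt g : FG).
Proof.
apply/ffunP => u; rewrite sum_ffunE (bigD1 u) //= big1 => [|v nuv].
  by rewrite !ffunE eqxx addr0 [_ *: _]mulr1.
by rewrite !ffunE eq_sym (negPf nuv) [_ *: _]mulr0.
Qed.

Lemma galg_eltMl (g u : gT) (a : FG) : (elt g * a) u = a (g^-1 * u)%g.
Proof.
rewrite ffunE (bigD1 g) //= big1 => [|v ngv].
  by rewrite ffunE eqxx mul1r addr0.
by rewrite ffunE (negPf ngv) mul0r.
Qed.

(** The element [c]; on an irreducible character it acts through the
    Frobenius-Schur indicator. *)
Definition square_mean : FG := #|gT|%:R^-1 *: \sum_g elt (g * g)%g.

Lemma square_mean_comm (a : FG) : a * square_mean = square_mean * a.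
Proof.
have comm_elt h : elt h * square_mean = square_mean * elt h.
  rewrite /square_mean -scalerAr -scalerAl; congr (_ *: _).
  rewrite mulr_sumr mulr_suml (reindex_inj (conjg_inj h)) /=.
  by apply: eq_bigr => g _; rewrite -!galg_eltM -conjMg -conjgC.
rewrite [a]galg_sum mulr_sumr mulr_suml; apply: eq_bigr => g _.
by rewrite -scalerAl comm_elt -[in RHS]scalerAr.
Qed.

(** The counterpart of [vintegral_sandwich] for the uniform measure on [G]. By
    linearity [a] may be taken in [G], where [g] is replaced by [a^-1 g]. *)
Lemma sandwich_mean (a : FG) :
  #|gT|%:R^-1 *: \sum_(g : gT) elt g * a * elt g = star a * square_mean.
Proof.
have -> : star a = \sum_h a h *: (elt h^-1%g : FG).
  rewrite [LHS]galg_sum (reindex_inj invg_inj); apply: eq_bigr => h _.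
  by rewrite ffunE invgK.
rewrite [in LHS](galg_sum a) mulr_suml.
under eq_bigr do rewrite mulr_sumr mulr_suml.
rewrite exchange_big scaler_sumr; apply: eq_bigr => h _.
rewrite -scalerAl -scalerAr scalerA mulrC -scalerA.
under eq_bigr do rewrite -scalerAr -scalerAl.
rewrite -scaler_sumr !scalerA mulrC; congr (_ *: _).
rewrite mulr_sumr (reindex_inj (mulgI h^-1%g)) /=; apply: eq_bigr => g _.
by rewrite -!galg_eltM !mulgA mulgK.
Qed.

End GroupElements.

Section RealGroupAlgebra.
Variables (R : realType) (gT : finGroupType).
Local Notation RG := (group_algebra R gT).
Local Notation elt := (galg_elt R).
Local Notation sqm := (square_mean R gT).

(** Write [c_K] for the left-hand side.  The mean over [G] of
    [g (g^-1 c_K)] is [c_K]; since [g^-1 c_K] is the integral of [k g k], it is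
    also the integral of the mean of [g k g k], that is of [k^* c k], and [c] is
    central.  Two polarizing groups thus have the same mean square. *)
Lemma vintegral_squares (K : set RG) (mu : probability (borel RG) R) :
  polarizing K mu -> vintegral mu K (fun k => k * k) = sqm.
Proof.
move=> polK; have [KU _ Kc _ [[K1 _] _]] := polK.
set cK := vintegral mu K _.
have tid : vtame K id by exact: vtame_id.
have tgkg g : vtame K (fun k => elt g * k * elt g).
  by apply: vtameM => //; [apply: vtameM => // |]; exact: vtame_cst.
have gcard : #|gT|%:R != 0 :> R.
  by rewrite pnatr_eq0 -lt0n; apply/card_gt0P; exists 1%g.
transitivity (#|gT|%:R^-1 *: \sum_(g : gT) elt g * (elt g^-1%g * cK)).
  under eq_bigr do rewrite mulrA -galg_eltM mulgV galg_elt1 mul1r.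
  by rewrite sumr_const -[cK *+ _]scaler_nat scalerA mulVf // scale1r.
transitivity (vintegral mu K (fun k => #|gT|%:R^-1 *:
    \sum_(g : gT) elt g * k * elt g * k)).
  have tgkgk g : vtame K (fun k => elt g * k * elt g * k) by exact: vtameM.
  have tsum : vtame K (fun k => \sum_(g : gT) elt g * k * elt g * k).
    move=> j; under eq_fun do rewrite linear_sum summxE.
    by apply: tame_sum => g; exact: tgkgk.
  rewrite (vintegral_linear mu Kc ( *:%R _) tsum) /= (vintegral_sum _ Kc) //.
  congr (_ *: _); apply: eq_bigr => g _.
  rewrite -(vintegral_sandwich polK) -vintegral_mull //; last first.
    by apply: vtameM => //; apply: vtameM => //; exact: vtame_cst.
  by apply: eq_vintegral => k _; rewrite star_galg_elt invgK !mulrA.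
rewrite -[RHS](vintegral_cst Kc sqm K1); apply: eq_vintegral => k Kk.
rewrite -mulr_suml scalerAl sandwich_mean.
by rewrite -mulrA -square_mean_comm mulrA (unitary_starK (KU _ Kk)) mul1r.
Qed.

(** If [(1 + c) x = 0], then [\sum_g <x, x + g^2 x> = 0].  As [x] and [g^2 x]
    have the same norm, [2 <x, x + g^2 x>] is the square norm of
    [y g = x + g^2 x], so every [y g] vanishes, in particular [y 1 = 2 x]. *)
Lemma one_plus_square_mean_inj (x : RG) : (1 + sqm) * x = 0 -> x = 0.
Proof.
move=> x0; apply/ffunP => u0; rewrite ffunE.
pose y g u := x u + x (g^-1 * (g^-1 * u))%g.
have sumy u : \sum_g y g u = 0.
  have /ffunP/(_ u) := x0.
  rewrite mulrDl mul1r /square_mean -scalerAl mulr_suml.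
  rewrite !ffunE sum_ffunE => /(congr1 ( *%R #|gT|%:R)); rewrite mulr0 => sum0.
  rewrite -[RHS]sum0 mulrDr mulVKf ?pnatr_eq0 -?lt0n; last first.
    by apply/card_gt0P; exists 1%g.
  rewrite /y big_split /= sumr_const mulr_natl; congr (_ + _).
  by apply: eq_bigr => g _; rewrite galg_eltM -mulrA !galg_eltMl.
have sq0 : \sum_g \sum_u y g u ^+ 2 = 0.
  have norm g : \sum_u x (g^-1 * (g^-1 * u))%g ^+ 2 = \sum_u x u ^+ 2.
    rewrite [RHS](reindex_inj (mulgI g^-1%g)) /=.
    by rewrite [RHS](reindex_inj (mulgI g^-1%g)).
  transitivity (\sum_g \sum_u (x u * y g u *+ 2)).
    apply: eq_bigr => g _.
    rewrite -[LHS]subr0 -[X in _ - X](subrr (\sum_u x u ^+ 2)).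
    rewrite -{1}(norm g) -!sumrB; apply: eq_bigr => u _.
    by rewrite /y; ring.
  rewrite exchange_big big1 // => u _.
  by rewrite sumrMnl -mulr_sumr sumy mulr0 mul0rn.
have := sq0; move/eqP; rewrite psumr_eq0 => [|g _]; last first.
  by apply: sumr_ge0 => u _; exact: sqr_ge0.
move=> /allP/(_ 1%g (mem_index_enum _))/=.
rewrite psumr_eq0 => [|u _]; last exact: sqr_ge0.
move=> /allP/(_ u0 (mem_index_enum _)) /=.
by rewrite sqrf_eq0 /y invg1 !mul1g -mulr2n mulrn_eq0 => /eqP.
Qed.

End RealGroupAlgebra.

(** * A finite polarizing subgroup and the polarization constant *)

Lemma uniform_law (R : realType) d (Y : measurableType d) (T : finType) (t0 : T)
    (e : T -> Y) :
  exists P : probability Y R,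
    forall B : set Y, P B = (#|T|%:R^-1 * \sum_t \1_B (e t))%:E.
Proof.
pose m (n : nat) : {measure set Y -> \bar R} := dirac (e (nth t0 (enum T) n)).
have c0 : 0 <= #|T|%:R^-1 :> R by rewrite invr_ge0.
pose mm := mscale (NngNum c0) (msum m #|T|).
have mmE B : mm B = (#|T|%:R^-1 * \sum_t \1_B (e t))%:E.
  rewrite /mm /mscale /= EFinM; congr (_ * _)%E.
  rewrite /msum -sumEFin cardE -(big_mkord xpredT (fun n => m n B)).
  by rewrite -[in RHS]big_enum [in RHS](big_nth t0).
have mmT : mm setT = 1%E.
  rewrite mmE; congr (_%:E); under eq_bigr do rewrite indicT.
  by rewrite sumr_const mulVf // pnatr_eq0 -lt0n; apply/card_gt0P; exists t0.
pose P : probability Y R :=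
  HB.pack mm (Measure_isProbability.Build _ _ _ mm mmT).
by exists P.
Qed.

Section SignedGroup.
Variables (R : realType) (gT : finGroupType).
Local Notation RG := (group_algebra R gT).
Local Notation elt := (galg_elt R).

Let selt (t : bool * gT) : RG := (-1) ^+ t.1 *: elt t.2.

Let seltM t t' : selt t * selt t' = selt (t.1 (+) t'.1, t.2 * t'.2)%g.
Proof.
by rewrite /selt -scalerAl -scalerAr scalerA -galg_eltM signr_addb.
Qed.

Let star_selt t : star (selt t) = selt (t.1, t.2^-1)%g.
Proof. by apply/ffunP => u; rewrite !ffunE (can2_eq invgK invgK). Qed.

(** The subgroup is that of the signed group elements, with its uniform law.
    It contains [-1], so translating by [-1] shows that its barycentre is its
    own opposite. *)
Lemma exists_polarizing : exists (K : set RG) (mu : probability (borel RG) R),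
  polarizing K mu.
Proof.
have [mu muE] := uniform_law R (false, 1%g) (selt : bool * gT -> borel RG).
exists (range selt), mu.
have KU : range selt `<=` @unitary_group R RG.
  move=> _ [t _ <-]; rewrite /unitary_group /= star_selt seltM /selt /=.
  by rewrite addbb mulgV scale1r.
have Kgrp : is_subgroup (range selt).
  split.
  - by exists (false, 1%g) => //; rewrite /selt scale1r.
  - move=> _ _ [t _ <-] [t' _ <-]; rewrite seltM.
    by exists (t.1 (+) t'.1, t.2 * t'.2)%g.
  - move=> u Ku; rewrite unitaryV; last exact: KU.
    by case: Ku => t _ <-; rewrite star_selt; exists (t.1, t.2^-1)%g.
have Kc : compact (range selt : set (natural_topology RG)).
  by apply: finite_compact; exact: finite_image.
have card0 : #|{: bool * gT}|%:R != 0 :> R.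
  by rewrite pnatr_eq0 -lt0n; apply/card_gt0P; exists (false, 1%g).
have Khaar : is_haar (range selt) mu.
  split.
    rewrite muE; congr (_%:E).
    rewrite (eq_bigr (fun=> 1)) ?sumr_const ?mulVf // => t _.
    by rewrite indicE mem_set //; exists t.
  move=> _ [t _ <-] B _; rewrite !muE; congr (_ * _)%:E.
  have tinj : injective (fun t' : bool * gT => (t.1 (+) t'.1, t.2 * t'.2)%g).
    by case=> [b g] [b' g'] [/addbI -> /mulgI ->].
  rewrite [RHS](reindex_inj tinj) /=; apply: eq_bigr => t' _.
  by rewrite -seltM !indicE.
split => //.
  move=> B _ KB; apply/vspaceP => a; rewrite memvf.
  rewrite [a]galg_sum; apply: rpred_sum => g _; apply: rpredZ; apply: KB.
  by exists (false, g) => //; rewrite /selt scale1r.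
split=> //; have KN : range selt (-1).
  by exists (true, 1%g) => //; rewrite /selt scaleN1r.
have tid := vtame_id Kc.
have := vintegral_translate Kc KU Kgrp Khaar KN tid.
rewrite (vintegral_mull mu Kc _ tid) mulN1r => /esym /eqP.
by rewrite -addr_eq0 -mulr2n -scaler_nat scaler_eq0 pnatr_eq0 => /eqP.
Qed.

End SignedGroup.

Section PolarizationConstant.
Variables (R : realType) (gT : finGroupType).
Local Notation RG := (group_algebra R gT).
Local Notation sqm := (square_mean R gT).

(** An injective left multiplication is onto, in particular hits [1]. *)
Lemma one_plus_square_mean_unit : 1 + sqm \is a GRing.unit.
Proof.
have inj0 : lker (amull (1 + sqm)) == 0%VS.
  apply/lker0P => x y; rewrite !lfunE /= => xy; apply/eqP.
  rewrite -subr_eq0; apply/eqP/one_plus_square_mean_inj.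
  by rewrite mulrBr xy subrr.
have := lker0_lfunVK inj0 1; rewrite lfunE /= => inv; exact: falg_unit inv.
Qed.

(** For uniqueness, the form [x y^*] at [x = y = 1] shows that any polarization
    constant is inverse to [1 + c]. *)
Lemma polarization_constantP :
  unique (@is_polarization_constant R RG) (1 + sqm)^-1.
Proof.
have unit1c := one_plus_square_mean_unit.
split=> [X Q Qh K mu polK x y | kappa kappaP].
  rewrite (vintegral_polarized polK x y Qh) (vintegral_squares polK).
  rewrite [Q x y * _](_ : _ = (1 + sqm) * Q x y) ?mulKr //.
  by rewrite mulrDr mulrDl mulr1 mul1r square_mean_comm.
have [K [mu polK]] := exists_polarizing R gT.
have Qh : @hermitian_form R RG RG^o (fun x y => x * star y).
  split=> [x y z | a x z | x y]; first exact: mulrDl.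
    by rewrite [a *: x]/(a * x) mulrA.
  by rewrite starM starK.
have := kappaP _ _ Qh K mu polK 1 1.
rewrite (vintegral_polarized polK _ _ Qh) (vintegral_squares polK).
rewrite star1 !mul1r => kappa1.
by apply: (mulIr unit1c); rewrite mulVr.
Qed.

End PolarizationConstant.

(** * Coefficients through irreducible characters *)

Section Characters.
Variables (C : numClosedFieldType) (gT : finGroupType).
Local Notation G := [set: gT]%G.
Local Notation CG := (group_algebra C gT).
Local Notation elt := (galg_elt C).

(** The positive definite matrix [H = \sum_h rG h (rG h)^*] satisfies
    [rG g H (rG g)^* = H], so that [rG g^-1] is conjugate to [(rG g)^*]. *)
Lemma trace_reprV n (rG : mx_representation C G n) g :
  \tr (rG g^-1%g) = (\tr (rG g))^*.
Proof.
pose adj m p (M : 'M[C]_(m, p)) := map_mx Num.conj (trmx M).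
have adjM m p q (M : 'M[C]_(m, p)) (N : 'M[C]_(p, q)) :
    adj _ _ (M *m N) = adj _ _ N *m adj _ _ M.
  by rewrite /adj trmx_mul map_mxM.
pose H := \sum_h rG h *m adj _ _ (rG h).
have rGM h k : rG (h * k)%g = rG h *m rG k by rewrite repr_mxM ?inE.
have HJ : rG g *m H *m adj _ _ (rG g) = H.
  rewrite [in RHS]/H (reindex_inj (mulgI g)) mulmx_sumr mulmx_suml.
  by apply: eq_bigr => h _; rewrite rGM adjM !mulmxA.
have Hunit : H \in unitmx.
  rewrite -row_free_unit -kermx_eq0; apply/rowV0P => v /sub_kermxP vH0.
  (* This is the value at [v] of the Hermitian form of matrix [H]; its summand
     of index [h = 1] is the square norm of [v]. *)
  have : \sum_h \sum_j `|(v *m rG h) 0 j| ^+ 2 = 0.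
    transitivity ((v *m H *m adj _ _ v) 0 0); last by rewrite vH0 mul0mx mxE.
    rewrite mulmx_sumr mulmx_suml summxE; apply: eq_bigr => h _.
    rewrite mulmxA -mulmxA -adjM mxE; apply: eq_bigr => j _.
    by rewrite normCK !mxE.
  move/eqP; rewrite psumr_eq0 => [/allP v0|h _]; last first.
    by apply: sumr_ge0 => j _; rewrite exprn_ge0.
  have /= := v0 1%g (mem_index_enum _).
  rewrite psumr_eq0 => [/allP {}v0|j _]; last by rewrite exprn_ge0.
  apply/rowP => j; have := v0 j (mem_index_enum _).
  by rewrite /= sqrf_eq0 normr_eq0 repr_mx1 mulmx1 mxE => /eqP.
have -> : rG g^-1%g = H *m adj _ _ (rG g) *m invmx H.
  apply: (canRL (mulmxK Hunit)); rewrite -[in LHS]HJ !mulmxA -rGM mulVg.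
  by rewrite repr_mx1 mul1mx.
by rewrite mxtrace_mulC mulmxA mulVmx // mul1mx /adj trace_map_mx mxtrace_tr.
Qed.

Definition repr_alg n (rG : mx_representation C G n) (a : CG) : 'M[C]_n :=
  \sum_g a g *: rG g.

Lemma repr_algM n (rG : mx_representation C G n) (a b : CG) :
  repr_alg rG (a * b) = repr_alg rG a *m repr_alg rG b.
Proof.
rewrite /repr_alg mulmx_suml; under eq_bigr do rewrite ffunE scaler_suml.
rewrite exchange_big; apply: eq_bigr => h _ /=.
rewrite (reindex_inj (mulgI h)) mulmx_sumr; apply: eq_bigr => g _.
by rewrite mulKg repr_mxM ?inE // -scalemxAl -scalemxAr scalerA.
Qed.

Lemma repr_alg_is_linear n (rG : mx_representation C G n) :
  linear (repr_alg rG).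
Proof.
move=> c a b; rewrite /repr_alg scaler_sumr -big_split.
apply: eq_bigr => g _ /=.
by rewrite !ffunE scalerDl scalerA.
Qed.

HB.instance Definition _ n (rG : mx_representation C G n) :=
  GRing.isLinear.Build C CG 'M[C]_n _ (repr_alg rG) (repr_alg_is_linear rG).

Lemma repr_alg_elt n (rG : mx_representation C G n) g :
  repr_alg rG (elt g) = rG g.
Proof.
rewrite /repr_alg (bigD1 g) //= big1 ?addr0 => [|h nhg].
  by rewrite ffunE eqxx scale1r.
by rewrite ffunE (negPf nhg) scale0r.
Qed.

Definition repr_char n (rG : mx_representation C G n) : {ffun gT -> C} :=
  [ffun g => \tr (rG g)].

Lemma deg_repr_char n (rG : mx_representation C G n) :
  deg (repr_char rG) = n%:R.
Proof. by rewrite /deg ffunE repr_mx1 mxtrace1. Qed.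

(** Schur's lemma: a central element acts as a scalar, which its trace gives. *)
Lemma repr_square_mean n (rG : mx_representation C G n) :
  mx_irreducible rG ->
  repr_alg rG (square_mean C gT) =
    (frobenius_schur (repr_char rG) / deg (repr_char rG))%:M.
Proof.
move=> irrG; have n_gt0 : (0 < n)%N by case/mx_irrP: irrG.
have /is_scalar_mxP[c sqc] : is_scalar_mx (repr_alg rG (square_mean C gT)).
  apply: (mx_abs_irr_cent_scalar (group_closure_closed_field irrG)).
  apply/centgmxP => g _; rewrite -repr_alg_elt -!repr_algM.
  by rewrite square_mean_comm.
have trc : frobenius_schur (repr_char rG) = c *+ n.
  rewrite -mxtrace_scalar -sqc linearZ linear_sum mxtraceZ linear_sum.
  congr (_ * _); apply: eq_bigr => g _.
  by rewrite ffunE /= repr_alg_elt expgS expg1.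
by rewrite sqc trc deg_repr_char -[c *+ n]mulr_natr mulfK ?pnatr_eq0 -?lt0n.
Qed.

(** The scalar [l] by which [1 + c] acts is nonzero since [1 + c] has an
    inverse; in particular [deg chi + frobenius_schur chi != 0], so that the
    quotient is a genuine one. *)
Lemma repr_one_plus_square_meanV n (rG : mx_representation C G n) (kappa : CG) :
  mx_irreducible rG -> (1 + square_mean C gT) * kappa = 1 ->
  let chi := repr_char rG in
  repr_alg rG kappa = (deg chi / (deg chi + frobenius_schur chi))%:M.
Proof.
move=> irrG kappaV chi; have n_gt0 : (0 < n)%N by case/mx_irrP: irrG.
have d0 : deg chi != 0 by rewrite deg_repr_char pnatr_eq0 -lt0n.
have op1 : repr_alg rG 1 = 1%:M by rewrite -galg_elt1 repr_alg_elt repr_mx1.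
have := congr1 (repr_alg rG) kappaV.
rewrite repr_algM linearD /= op1 repr_square_mean // -/chi.
rewrite -raddfD mul_scalar_mx.
set l := 1 + _ => lk.
have l0 : l != 0.
  apply/eqP => l0; move/eqP: lk; rewrite l0 scale0r eq_sym.
  by rewrite -mxrank_eq0 mxrank1 -leqn0 leqNgt n_gt0.
have -> : repr_alg rG kappa = l^-1%:M.
  by rewrite -[LHS]scale1r -(mulVf l0) -scalerA lk scale_scalar_mx mulr1.
by congr (_%:M); rewrite /l -[X in X + _](divff d0) -mulrDl invf_div //.
Qed.

Lemma pchar'_setT : ([pchar C]^').-group%g G.
Proof. by apply/pgroupP => p _ _; rewrite inE /= pchar_num. Qed.

Let sG : irrType C G := DecSocleType (regular_repr C G).

Lemma trace_regular g :
  \sum_(i : sG) deg (repr_char (irr_repr i)) * \tr (irr_repr i g) =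
  if g == 1%g then #|gT|%:R else 0.
Proof.
have := mxtrace_regular_pchar sG pchar'_setT
  (@group_closure_closed_field C gT G) (finset.in_setT g).
have cardG : #|G| = #|gT| by apply: eq_card => x; rewrite !inE.
have -> : \tr (regular_repr C G g) = if g == 1%g then #|gT|%:R else 0.
  have [->|ng1] := eqVneq.
    by rewrite repr_mx1 mxtrace1; congr _%:R; exact: cardG.
  rewrite [\tr _]big1 // => i _; rewrite 2!mxE /=.
  rewrite -(inj_eq enum_val_inj) gring_indexK ?groupM ?enum_valP ?inE //.
  by rewrite eq_mulVg1 mulKg (negbTE ng1).
by move=> ->; apply: eq_bigr => i _; rewrite deg_repr_char mulr_natl.
Qed.

(** The central idempotent of the [i]-th Wedderburn component acts as [1] on the
    [i]-th irreducible representation and as [0] on the others, and its trace is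
    determined by the character. *)
Lemma irr_char_inj : injective (fun i : sG => repr_char (irr_repr i)).
Proof.
move=> i j /= eq_ij; apply/eqP; apply: contraT => nij.
have /envelop_mxP[a ea] : (Wedderburn_id i \in group_ring C G)%MS.
  rewrite -(Wedderburn_sum_pchar sG pchar'_setT).
  by rewrite (sumsmx_sup i) // Wedderburn_id_mem.
have tr (k : sG) : \tr (gring_op (irr_repr k) (Wedderburn_id i)) =
    \sum_g a g * repr_char (irr_repr k) g.
  rewrite ea !linear_sum; apply: eq_big => [g|g _]; first by rewrite inE.
  by rewrite !linearZ /= gring_opG ?inE // ffunE.
have := tr i; rewrite eq_ij -tr (op_Wedderburn_id_pchar pchar'_setT).
rewrite (irr_repr'_op0_pchar pchar'_setT nij) ?Wedderburn_id_mem //.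
rewrite mxtrace1 mxtrace0 => /eqP; rewrite pnatr_eq0 => /eqP n0.
by have := irr_degree_gt0 i; rewrite n0.
Qed.

(** Every irreducible representation is similar to a constituent of the regular
    one, so [Irr] is enumerated by the isotypic components of the latter. *)
Lemma sum_Irr (F : {ffun gT -> C} -> C) :
  \sum_(chi \in @Irr C gT) F chi = \sum_(i : sG) F (repr_char (irr_repr i)).
Proof.
rewrite -[RHS]big_enum.
rewrite -(big_map (fun i : sG => repr_char (irr_repr i)) xpredT F).
rewrite [RHS]fsbig_seq; last by rewrite (map_inj_uniq irr_char_inj) enum_uniq.
apply: eq_fsbigl; apply/seteqP.
split=> [_ [n [rG [irrG ->]]] | _ /mapP[i _ ->]].
  have rsim := rsim_irr_comp_pchar sG pchar'_setT irrG.
  apply/mapP; exists (irr_comp sG rG); first by rewrite mem_enum.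
  apply/ffunP => g; rewrite !ffunE.
  by rewrite (mxtrace_rsim rsim) ?inE.
by exists _, (irr_repr i); split=> //; exact: socle_irr.
Qed.

(** Fourier inversion: the regular character, which is [#|gT|] at [1] and [0]
    elsewhere, picks the coefficient at [1] of [a g^-1]. *)
Lemma galg_trace_inversion (a : CG) g :
  a g = #|gT|%:R^-1 * \sum_(i : sG) deg (repr_char (irr_repr i)) *
     \tr (repr_alg (irr_repr i) a *m irr_repr i g^-1%g).
Proof.
have N0 : #|gT|%:R != 0 :> C.
  by rewrite pnatr_eq0 -lt0n; apply/card_gt0P; exists g.
apply: (canRL (mulKf N0)).
transitivity (\sum_(i : sG) \sum_h a h *
    (deg (repr_char (irr_repr i)) * \tr (irr_repr i (h * g^-1)%g))); last first.
  apply: eq_bigr => i _; rewrite mulmx_suml linear_sum mulr_sumr.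
  apply: eq_bigr => h _; rewrite -scalemxAl linearZ /= repr_mxM ?inE //.
  by rewrite mulrCA.
rewrite exchange_big (bigD1 g) //= [X in _ + X]big1 ?addr0 => [|h nhg].
  by rewrite -mulr_sumr trace_regular mulgV eqxx mulrC.
by rewrite -mulr_sumr trace_regular -eq_mulgV1 (negPf nhg) mulr0.
Qed.

(** Since [kappa] acts as [deg chi / (deg chi + s(chi))], this scalar comes out
    of the trace, leaving [chi g^-1], the conjugate of [chi g]. *)
Lemma one_plus_square_meanV_coef (kappa : CG) g :
  (1 + square_mean C gT) * kappa = 1 ->
  kappa g = #|gT|%:R^-1 * \sum_(chi \in @Irr C gT)
    deg chi ^+ 2 * (chi g)^* / (deg chi + frobenius_schur chi).
Proof.
move=> kappaV; rewrite galg_trace_inversion sum_Irr; congr (_ * _).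
apply: eq_bigr => i _.
rewrite repr_one_plus_square_meanV //; last exact: socle_irr.
rewrite mul_scalar_mx mxtraceZ trace_reprV [repr_char _ g]ffunE.
by rewrite mulrA mulrA -expr2 mulrAC.
Qed.

End Characters.

(** * Extension of scalars and conclusion *)

Section Complexification.
Variables (R : realType) (gT : finGroupType).

Lemma galg_complexM (a b : group_algebra R gT) :
  galg_complex (a * b) = galg_complex a * galg_complex b.
Proof.
apply/ffunP => g; rewrite !ffunE rmorph_sum; apply: eq_bigr => h _.
by rewrite rmorphM !ffunE.
Qed.

Lemma galg_complex_elt (g : gT) :
  galg_complex (galg_elt R g) = galg_elt R[i] g.
Proof. by apply/ffunP => h; rewrite !ffunE rmorph_nat. Qed.

Lemma galg_complex_one_plus_square_mean :
  galg_complex (1 + square_mean R gT) = 1 + square_mean R[i] gT.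
Proof.
apply/ffunP => h; rewrite !ffunE !sum_ffunE rmorphD rmorphM rmorph_nat fmorphV.
rewrite rmorph_nat rmorph_sum; congr (_ + _ * _); apply: eq_bigr => g _.
by rewrite !ffunE rmorph_nat.
Qed.

End Complexification.

Local Close Scope classical_set_scope.

Theorem proposition5p4 (R : realType) (gT : finGroupType) :
  exists kappa : group_algebra R gT,
    unique (@is_polarization_constant R (group_algebra R gT)) kappa /\
    galg_complex kappa =
      #|gT|%:R^-1 *:
        \sum_(g : gT)
          (\sum_(chi \in @Irr R[i] gT)
              deg chi ^+ 2 * (chi g)^* / (deg chi + frobenius_schur chi))
          *: galg_elt R[i] g.
Proof.
exists (1 + square_mean R gT)^-1; split; first exact: polarization_constantP.
have := congr1 (@galg_complex R gT) (mulrV (one_plus_square_mean_unit R gT)).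
rewrite galg_complexM galg_complex_one_plus_square_mean galg_complex_elt.
move=> kappaV.
rewrite [LHS]galg_sum scaler_sumr; apply: eq_bigr => g _.
by rewrite (one_plus_square_meanV_coef g kappaV) scalerA.
Qed.
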